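(* Let $\mathcal{X}$ be a nonempty finite set with $N=|\mathcal{X}|$, and let $\{\rho_x\}_{x\in\mathcal{X}}$ be density operators on a Hilbert space $\mathcal{H}$ of finite dimension $d$. For each integer $n\ge1$ let $\mathcal{Q}_n(X\to A)$ be the maximal quantum leakage for $n$ copies of the states. Then $\mathcal{Q}_n(X\to A)$ is a non-decreasing function of $n$, and for every $n\ge 1$ $$\mathcal{Q}_n(X\to A)\le\min\{\log(N),\ \log(d^{2n})\}.$$
   Context: A density operator is a positive semidefinite operator of unit trace. A POVM on a Hilbert space $\mathcal{K}$ with finite outcome set $\mathcal{Y}$ is a family $\{F_y\}_{y\in\mathcal{Y}}$ of operators on $\mathcal{K}$ with $F_y\ge0$ and $\sum_yF_y=I$. $\log$ is the natural logarithm. The maximal quantum leakage for $n$ copies is $$\mathcal{Q}_n(X\to A)=\log\Big(\max_{\{F_y\}_{y\in\mathcal{Y}}}\sum_{y\in\mathcal{Y}}\max_{x\in\mathcal{X}}\mathrm{Tr}(\rho_x^{\otimes n}F_y)\Big),$$ the maximum being over all POVMs $\{F_y\}_{y\in\mathcal{Y}}$ on the $n$-copy space $\mathcal{H}^{\otimes n}$ with arbitrary finite outcome set $\mathcal{Y}$. *)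

(* Defs.v *)
From HB Require Import structures.
From mathcomp Require Import all_boot all_order all_algebra.
From mathcomp Require Import complex mxtens.
From mathcomp Require Import boolp classical_sets reals exp.

Set Implicit Arguments.
Unset Strict Implicit.
Unset Printing Implicit Defensive.

Import Order.TTheory GRing.Theory Num.Theory.
Local Open Scope classical_set_scope.
Local Open Scope ring_scope.
Local Open Scope complex_scope.
Local Open Scope sesquilinear_scope.

(* Operators on a Hilbert space of dimension m are m x m matrices over R[i],
   in a fixed orthonormal basis. The n-copy space has dimension d ^ n, and the
   n-th tensor power of A is ntensmx A n (iterated Kronecker product). *)

Section QuantumLeakage.
Variable R : realType.

(* The order of R[i] makes 0 <= z include that z is real. *)
Definition psdmx m (A : 'M[R[i]]_m) : Prop :=
  A \is hermsymmx /\
  forall v : 'cV[R[i]]_m, 0 <= (v ^t* *m A *m v) 0 0.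

Definition density_operator m (A : 'M[R[i]]_m) : Prop :=
  psdmx A /\ \tr A = 1.

Definition povm m (Y : finType) (F : Y -> 'M[R[i]]_m) : Prop :=
  (forall y, psdmx (F y)) /\ \sum_(y : Y) F y = 1%:M.

(* For positive semidefinite matrices the traces are nonnegative reals, so
   taking real parts loses nothing, and over a nonempty X the default value 0
   of the iterated maximum plays no role. *)
Definition povm_value m (X Y : finType)
    (sigma : X -> 'M[R[i]]_m) (F : Y -> 'M[R[i]]_m) : R :=
  \sum_(y : Y) \big[Num.max/0]_(x : X) complex.Re (\tr (sigma x *m F y)).

Definition povm_values m (X : finType) (sigma : X -> 'M[R[i]]_m) : set R :=
  [set r | exists (Y : finType) (F : Y -> 'M[R[i]]_m),
     povm F /\ r = povm_value sigma F].

(* The supremum is a maximum: grouping the outcomes by a maximizing x turns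
   any POVM into one indexed by X without decreasing its value, and the POVMs
   indexed by X form a compact set. *)
Definition max_quantum_leakage d (X : finType) (rho : X -> 'M[R[i]]_d)
    (n : nat) : R :=
  ln (sup (povm_values (fun x => ntensmx (rho x) n))).

End QuantumLeakage.

(* Main.v *)
Require Import Defs.
From mathcomp Require Import all_boot all_order all_algebra.
From mathcomp Require Import complex mxtens.
From mathcomp Require Import boolp classical_sets reals exp.

Set Implicit Arguments.
Unset Strict Implicit.
Unset Printing Implicit Defensive.

Import Order.TTheory GRing.Theory Num.Theory.
Local Open Scope ring_scope.
Local Open Scope complex_scope.

(** Padding a POVM [F] on n copies to [1 (x) F] on n + 1 copies leaves every
    [Tr (rho_x^(x)n F_y)] unchanged because [Tr rho_x = 1]; hence monotonicity.
    Since these traces are nonnegative, the maximum over x is at most the sum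
    over x, which gives the bound N; since [Tr (sigma F_y) <= Tr F_y], it is
    also at most [Tr F_y], which gives even the bound [d ^ n], the dimension
    of the n-copy space. *)

Section PositiveSemidefinite.
Local Open Scope sesquilinear_scope.
Variable R : realType.
Local Notation C := R[i].

Lemma trmxC_mul m n p (A : 'M[C]_(m, n)) (B : 'M[C]_(n, p)) :
  (A *m B) ^t* = B ^t* *m A ^t*.
Proof. by rewrite trmx_mul map_mxM. Qed.

Lemma trmxC_tens m n p q (A : 'M[C]_(m, n)) (B : 'M[C]_(p, q)) :
  (A *t B) ^t* = A ^t* *t B ^t*.
Proof. by rewrite trmx_tens map_mxT. Qed.

Lemma diag_gram_ge0 m n (M : 'M[C]_(m, n)) i : 0 <= (M ^t* *m M) i i.
Proof.
by rewrite mxE sumr_ge0 // => j _; rewrite !mxE mulrC mul_conjC_ge0.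
Qed.

Lemma psdmx_gram m n (M : 'M[C]_(m, n)) : psdmx (M ^t* *m M).
Proof.
split=> [|v].
  by apply/is_hermitianmxP; rewrite expr0 scale1r trmxC_mul trmxCK.
by rewrite mulmxA -trmxC_mul -mulmxA diag_gram_ge0.
Qed.

Lemma psdmx_conj m n (P : 'M[C]_(m, n)) (A : 'M[C]_m) :
  psdmx A -> psdmx (P ^t* *m A *m P).
Proof.
move=> [/is_hermitianmxP]; rewrite expr0 scale1r => Ah A0; split=> [|v].
  apply/is_hermitianmxP; rewrite expr0 scale1r 2!trmxC_mul trmxCK mulmxA.
  by rewrite -Ah.
by rewrite !mulmxA -trmxC_mul -mulmxA A0.
Qed.

Lemma psdmx_diag_ge0 n (A : 'M[C]_n) i : psdmx A -> 0 <= A i i.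
Proof.
move=> [_ /(_ (delta_mx i 0))].
by rewrite trmx_delta map_delta_mx -rowE -colE !mxE.
Qed.

Lemma psdmx_trace_ge0 n (A : 'M[C]_n) : psdmx A -> 0 <= \tr A.
Proof. by move=> Apsd; apply: sumr_ge0 => i _; apply: psdmx_diag_ge0. Qed.

(** Hermitian matrices are normal, so the spectral theorem applies; each eigenvalue is a diagonal
    entry of [A] conjugated by a unitary, hence nonnegative. *)
Lemma psdmx_spectral n (A : 'M[C]_n) : psdmx A ->
  exists2 P : 'M[C]_n, P \is unitarymx &
  exists2 s : 'rV[C]_n, (forall i, 0 <= s 0 i) & A = P ^t* *m diag_mx s *m P.
Proof.
move=> Apsd; have [Ah _] := Apsd.
have PU := spectral_unitarymx A.
have /hermitian_normalmx/orthomx_spectralP := Ah.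
rewrite (invmx_unitary PU) => AE.
exists (spectralmx A) => //; exists (spectral_diag A) => // i.
(* The double adjoint gives the shape [Q ^t* *m A *m Q] that [psdmx_conj] expects, with [Q] the
   adjoint of the spectral matrix. *)
have -> : spectral_diag A 0 i =
    ((spectralmx A)^t*^t* *m A *m (spectralmx A)^t*) i i.
  rewrite [in X in (_ *m X *m _) i i]AE trmxCK !mulmxA (unitarymxP PU) mul1mx.
  by rewrite -mulmxA (unitarymxP PU) mulmx1 !mxE eqxx.
exact/psdmx_diag_ge0/psdmx_conj.
Qed.

(** The factor [M] scales the rows of the eigenbasis by square roots of the eigenvalues. Gram
    factorizations are compatible with tensor products, which yields [psdmx_tens]. *)
Lemma psdmx_gramP n (A : 'M[C]_n) :
  psdmx A <-> exists M : 'M[C]_n, A = M ^t* *m M.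
Proof.
split=> [/psdmx_spectral[P _ [s s0 ->]]|[M ->]]; last exact: psdmx_gram.
exists (diag_mx (map_mx sqrtC s) *m P).
rewrite trmxC_mul -!mulmxA; congr (_ *m _); rewrite mulmxA; congr (_ *m _).
rewrite tr_diag_mx map_diag_mx mulmx_diag; congr diag_mx.
apply/rowP => j; rewrite !mxE /=.
(* The square roots are nonnegative, hence real and fixed by conjugation. *)
have /geC0_conj -> : 0 <= sqrtC (s 0 j) by rewrite sqrtC_ge0 s0.
by rewrite -{1}[s 0 j]sqrtCK expr2.
Qed.

Lemma psdmx1 n : psdmx (1%:M : 'M[C]_n).
Proof. by apply/psdmx_gramP; exists 1%:M; rewrite trmx1 map_mx1 mulmx1. Qed.

Lemma psdmx_tens m n (A : 'M[C]_m) (B : 'M[C]_n) :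
  psdmx A -> psdmx B -> psdmx (A *t B).
Proof.
move=> /psdmx_gramP[M ->] /psdmx_gramP[N ->]; apply/psdmx_gramP.
by exists (M *t N); rewrite trmxC_tens tensmx_mul.
Qed.

Lemma mxtrace_tens m n (A : 'M[C]_m) (B : 'M[C]_n) :
  \tr (A *t B) = \tr A * \tr B.
Proof. by rewrite mulr_sum; apply: eq_bigr => i _; rewrite !mxE. Qed.

(** In an eigenbasis of [B] the trace of the product is the sum of the eigenvalues of [B] weighted
    by the diagonal entries of [A], each of which lies between 0 and [\tr A]. *)
Lemma mxtrace_psdmx_mul n (A B : 'M[C]_n) :
  psdmx A -> psdmx B -> 0 <= \tr (A *m B) <= \tr A * \tr B.
Proof.
move=> Apsd /psdmx_spectral[P PU [s s0 ->]].
have A'psd : psdmx (P *m A *m P ^t*).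
  by rewrite -{1}(trmxCK P); apply: psdmx_conj.
have -> : \tr (A *m (P ^t* *m diag_mx s *m P)) =
    \sum_i (P *m A *m P ^t*) i i * s 0 i.
  rewrite !mulmxA mxtrace_mulC !mulmxA mul_mx_diag.
  by apply: eq_bigr => i _; rewrite !mxE.
have <- : \tr (P *m A *m P ^t*) = \tr A.
  by rewrite -mulmxA mxtrace_mulC mulmxKtV.
have -> : \tr (P ^t* *m diag_mx s *m P) = \sum_i s 0 i.
  by rewrite -mulmxA mxtrace_mulC mulmxtVK // mxtrace_diag.
apply/andP; split.
  by apply: sumr_ge0 => i _; rewrite mulr_ge0 ?s0 ?psdmx_diag_ge0.
rewrite mulr_sumr; apply: ler_sum => i _; rewrite ler_wpM2r ?s0 //.
rewrite /mxtrace (bigD1 i) //= lerDl sumr_ge0 // => j _.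
exact: psdmx_diag_ge0.
Qed.

End PositiveSemidefinite.

Section Leakage.
Variable R : realType.
Local Notation C := R[i].

Lemma Re_mono : {homo (@complex.Re R) : x y / x <= y}.
Proof. by move=> x y; rewrite lecE => /andP[]. Qed.

Lemma Re_sum (I : finType) (f : I -> C) :
  complex.Re (\sum_i f i) = \sum_i complex.Re (f i).
Proof. exact: (raddf_sum (@complex.Re R : Rcomplex R -> R)). Qed.

Lemma Re_nat n : complex.Re (n%:R : C) = n%:R.
Proof. by rewrite -(rmorph_nat (@real_complex R)). Qed.

Lemma density_tens m n (A : 'M[C]_m) (B : 'M[C]_n) :
  density_operator A -> density_operator B -> density_operator (A *t B).
Proof.
move=> [Ap At] [Bp Bt]; split; first exact: psdmx_tens.
by rewrite mxtrace_tens At Bt mulr1.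
Qed.

(** The induction starts at one copy, where the tensor power is [A] itself. *)
Lemma density_ntens d (A : 'M[C]_d) n :
  density_operator A -> density_operator (ntensmx A n.+1).
Proof. by move=> Ad; elim: n => // n IHn; exact: density_tens. Qed.

Lemma density_dim_gt0 d (A : 'M[C]_d) : density_operator A -> (0 < d)%N.
Proof.
case: d A => // A [_ /eqP].
by rewrite /mxtrace big_ord0 eq_sym oner_eq0.
Qed.

Section Values.
Variables (X : finType) (m : nat) (sigma : X -> 'M[C]_m).
Hypothesis sigma_density : forall x, density_operator (sigma x).

Lemma povm_prob_ge0 (Y : finType) (F : Y -> 'M[C]_m) x y :
  povm F -> 0 <= complex.Re (\tr (sigma x *m F y)).
Proof.
move=> [Fp _]; have [sp _] := sigma_density x.
by have /andP[/Re_mono] := mxtrace_psdmx_mul sp (Fp y).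
Qed.

Lemma povm_value_le_card (Y : finType) (F : Y -> 'M[C]_m) :
  povm F -> povm_value sigma F <= #|X|%:R.
Proof.
move=> FP; have [_ F1] := FP.
apply: (@le_trans _ _
    (\sum_y \sum_x complex.Re (\tr (sigma x *m F y)))).
  apply: ler_sum => y _; apply/bigmax_leP.
  split=> [|x _]; first by apply: sumr_ge0 => x _; exact: povm_prob_ge0.
  by rewrite (bigD1 x) //= lerDl sumr_ge0 // => z _; exact: povm_prob_ge0.
(* Summing over the outcomes first, each [x] contributes [\tr (sigma x) = 1], because the POVM sums
   to the identity. *)
rewrite exchange_big /= (eq_bigr (fun=> 1)) ?sumr_const // => x _.
rewrite -Re_sum -raddf_sum -mulmx_sumr F1 mulmx1 /=.
by have [_ ->] := sigma_density x.
Qed.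

Lemma povm_value_le_dim (Y : finType) (F : Y -> 'M[C]_m) :
  povm F -> povm_value sigma F <= m%:R.
Proof.
move=> [Fp F1].
apply: (@le_trans _ _ (\sum_y complex.Re (\tr (F y)))).
  apply: ler_sum => y _; apply/bigmax_leP; split=> [|x _].
    exact/(@Re_mono 0)/psdmx_trace_ge0.
  have [sp s1] := sigma_density x.
  by have /andP[_ /Re_mono] := mxtrace_psdmx_mul sp (Fp y); rewrite s1 mul1r.
by rewrite -Re_sum -raddf_sum F1 /= mxtrace1 Re_nat.
Qed.

Hypothesis X_nonempty : (0 < #|X|)%N.

(** The trivial measurement with a single outcome attains this. It makes the set of values nonempty
    and keeps its supremum in the domain where [ln] is monotone. *)
Lemma povm_values_ge1 : exists2 r, povm_values sigma r & 1 <= r.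
Proof.
have /card_gt0P[x _] := X_nonempty.
exists (povm_value sigma (fun _ : unit => 1%:M)).
  exists unit, (fun=> 1%:M); split=> //; split=> [y|]; first exact: psdmx1.
  by rewrite big_const card_unit /= addr0.
rewrite /povm_value big_const card_unit /= addr0.
apply: (le_trans _ (le_bigmax _ _ x)).
by rewrite mulmx1; have [_ ->] := sigma_density x.
Qed.

Lemma has_sup_povm_values : has_sup (povm_values sigma).
Proof.
split; first by have [r] := povm_values_ge1; exists r.
by exists #|X|%:R => _ [Y [F [FP ->]]]; exact: povm_value_le_card.
Qed.

Lemma sup_povm_values_ge1 : 1 <= sup (povm_values sigma).
Proof.
have [r rv /le_trans] := povm_values_ge1; apply.
exact: (sup_upper_bound has_sup_povm_values).
Qed.

(** Reduces each inequality of the theorem to a bound on single POVMs; for monotonicity, [b] is the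
    supremum for one more copy. *)
Lemma ln_sup_povm_values_le b :
  (forall (Y : finType) (F : Y -> 'M[C]_m), povm F -> povm_value sigma F <= b) ->
  ln (sup (povm_values sigma)) <= ln b.
Proof.
move=> le_b.
have sup_b : sup (povm_values sigma) <= b.
  apply: ge_sup; first by have [] := has_sup_povm_values.
  by move=> _ [Y [F [FP ->]]]; exact: le_b.
have sup_gt0 := lt_le_trans ltr01 sup_povm_values_ge1.
by rewrite ler_ln // posrE (lt_le_trans sup_gt0).
Qed.

End Values.

(** The padding factor is on the left because [ntensmx] adds each new copy there. *)
Lemma povm_values_tens (X : finType) m n
    (sigma : X -> 'M[C]_m) (tau : X -> 'M[C]_n) :
  (forall x, \tr (sigma x) = 1) ->
  (povm_values tau `<=` povm_values (fun x => sigma x *t tau x))%classic.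
Proof.
move=> sigma1 _ [Y [F [[Fp F1] ->]]].
exists Y, (fun y => 1%:M *t F y); split; last first.
  apply: eq_bigr => y _; apply: eq_bigr => x _.
  by rewrite tensmx_mul mulmx1 mxtrace_tens sigma1 mul1r.
split=> [y|]; first by apply: psdmx_tens => //; exact: psdmx1.
have -> : \sum_y 1%:M *t F y = (1%:M : 'M[C]_m) *t \sum_y F y.
  apply/matrixP => i j; rewrite summxE [RHS]mxE summxE mulr_sumr.
  by apply: eq_bigr => y _; rewrite mxE.
(* The tensor product of identities is the identity: the Kronecker deltas of the two components
   multiply to that of the pair, as [mxtens_index] is injective. *)
rewrite F1; apply/matrixP => i j.
case: (mxtens_indexP i) => i0 i1; case: (mxtens_indexP j) => j0 j1.
rewrite tensmxE !mxE -natrM mulnb -xpair_eqE.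
by rewrite (inj_eq (can_inj (@mxtens_indexK _ _))).
Qed.

End Leakage.

Theorem proposition1 (R : realType) (X : finType) (d : nat)
    (rho : X -> 'M[R[i]]_d)
    (X_nonempty : (0 < #|X|)%N)
    (rho_density : forall x : X, density_operator (rho x)) :
  (forall m n : nat, (1 <= m)%N -> (m <= n)%N ->
     max_quantum_leakage rho m <= max_quantum_leakage rho n) /\
  (forall n : nat, (1 <= n)%N ->
     max_quantum_leakage rho n
       <= Num.min (ln (#|X|%:R)) (ln ((d ^ (2 * n))%N%:R))).
Proof.
have ntens_density n x := @density_ntens R d (rho x) n (rho_density x).
split=> [m n|[//|n] _].
  case: m => // m _; elim: n => // n IHn.
  rewrite leq_eqVlt => /predU1P[<- //|lt_mn].
  (* With zero copies excluded, the larger power is by conversion [rho x] tensored with the smaller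
     one. *)
  apply: (le_trans (IHn lt_mn)); case: n lt_mn {IHn} => // n _.
  apply: ln_sup_povm_values_le => // Y F FP.
  have rho1 x : \tr (rho x) = 1 by have [] := rho_density x.
  apply: (sup_upper_bound (has_sup_povm_values (ntens_density n.+1) X_nonempty)).
  by apply: (povm_values_tens rho1); exists Y, F.
rewrite le_min; apply/andP; split; apply: ln_sup_povm_values_le => // Y F FP.
  exact: povm_value_le_card.
have /card_gt0P[x _] := X_nonempty.
(* A positive base is what lets [leq_pexp2l] pass from [d ^ n] to [d ^ (2 * n)]. *)
have d_gt0 := density_dim_gt0 (rho_density x).
apply: (le_trans (povm_value_le_dim (ntens_density n) FP)).
by rewrite ler_nat leq_pexp2l // leq_pmull.
Qed.
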